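(* Let $f\in\mathbb{R}[X]$ be a polynomial of even degree $d\geq 2$ with negative leading coefficient. Then $\mathrm{J}(f)\subseteq\mathbb{R}$ if and only if $f$ has at least one real fixed point and $[a_{1},a_{2}]\subseteq\mathrm{I}(f)$, where $a_{1}$ is the smallest real fixed point of $f$ and $a_{2}$ is the largest real root of $f(X)=a_{1}$.
   Context: $\mathrm{J}(f)\subseteq\mathbb{P}^1(\mathbb{C})$ is the Julia set of $f$, i.e. the complement of the maximal open subset of $\mathbb{P}^1(\mathbb{C})$ on which the family of iterates of $f$ is equicontinuous. For $f\in\mathbb{R}[X]$ of degree $d\ge2$, the critical interval $\mathrm{I}(f)$ is the set of all $t\in\mathbb{R}$ such that $f(X)=t$ has $d$ real solutions counted with multiplicity. *)

(* Defs.v *)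
From HB Require Import structures.
From mathcomp Require Import all_boot all_order all_algebra.
From mathcomp Require Import all_classical all_reals all_analysis.
From mathcomp Require Import complex polyrcf.
From mathcomp Require Import ring lra.

Set Implicit Arguments.
Unset Strict Implicit.
Unset Printing Implicit Defensive.

Import Order.TTheory GRing.Theory Num.Theory.
Import ComplexField.Normc.

Local Open Scope classical_set_scope.
Local Open Scope ring_scope.

(* The complex projective line, as C with a point at infinity [None]. *)
Definition P1C (R : realType) : Type := option R[i].

Section ChordalMetric.
Context {R : realType}.
Implicit Types p q r : P1C R.

(* Homogeneous coordinates: z is [z : 1] and infinity is [1 : 0]. *)
Definition hcoord p : R[i] * R[i] := if p is Some z then (z, 1) else (1, 0).

Definition hnorm p : R :=
  Num.sqrt (normc (hcoord p).1 ^+ 2 + normc (hcoord p).2 ^+ 2).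

(* The chordal distance: 2|z - w| / (sqrt(1 + |z|^2) sqrt(1 + |w|^2)) between
   finite points and 2 / sqrt(1 + |z|^2) between z and infinity. *)
Definition chordal p q : R :=
  2 * normc ((hcoord p).1 * (hcoord q).2 - (hcoord p).2 * (hcoord q).1)
    / (hnorm p * hnorm q).

Lemma normc_sq (z : R[i]) : normc z ^+ 2 = complex.Re z ^+ 2 + complex.Im z ^+ 2.
Proof. by case: z => a b /=; rewrite sqr_sqrtr // addr_ge0 ?sqr_ge0. Qed.

Lemma normc_ge0 (z : R[i]) : 0 <= normc z.
Proof. by case: z => a b /=; exact: sqrtr_ge0. Qed.

Lemma hnorm_gt0 p : 0 < hnorm p.
Proof.
rewrite /hnorm sqrtr_gt0 !normc_sq; case: p => [[a b]|] /=.
  by rewrite expr1n expr0n addr0 ltr_wpDl ?addr_ge0 ?sqr_ge0.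
by rewrite expr1n !expr0n !addr0.
Qed.

Lemma normcN (z : R[i]) : normc (- z) = normc z.
Proof. by case: z => a b /=; rewrite !sqrrN. Qed.

Lemma normc_real (x : R) : 0 <= x -> normc x%:C%C = x.
Proof. by move=> x0; rewrite /= expr0n addr0 sqrtr_sqr ger0_norm. Qed.

Lemma normc_triangle (z w : R[i]) : normc (z + w) <= normc z + normc w.
Proof. by have := ler_normD z w; rewrite -lecR rmorphD. Qed.

Lemma chordalxx p : chordal p p = 0.
Proof. by rewrite /chordal mulrC [_.2 * _]mulrC subrr normc0 !(mulr0, mul0r). Qed.

Lemma chordal_positivity p q : chordal p q = 0 -> p = q.
Proof.
move/eqP; rewrite /chordal !mulf_eq0 invr_eq0 mulf_eq0 pnatr_eq0 /=.
rewrite !(gt_eqF (hnorm_gt0 _)) !orbF => /eqP/eq0_normc.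
case: p q => [z|] [w|] //=; rewrite ?mulr1 ?mul1r ?mulr0 ?mul0r ?subr0 ?sub0r.
- by move=> /subr0_eq ->.
- by move=> /eqP; rewrite oppr_eq0 oner_eq0.
- by move=> /eqP; rewrite oner_eq0.
Qed.

Lemma chordalC p q : chordal p q = chordal q p.
Proof.
rewrite /chordal -normcN opprB [hnorm p * _]mulrC.
by rewrite [(hcoord p).2 * _]mulrC [(hcoord p).1 * _]mulrC.
Qed.

Lemma hcoord_cauchy_schwarz p q :
  normc ((hcoord p).1^*%C * (hcoord q).1 + (hcoord p).2^*%C * (hcoord q).2)
    <= hnorm p * hnorm q.
Proof.
rewrite /hnorm -sqrtrM ?addr_ge0 ?sqr_ge0 //.
rewrite -(ger0_norm (normc_ge0 _)) -sqrtr_sqr ler_wsqrtr // !normc_sq.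
case: (hcoord p) (hcoord q) => [[a b] [c d]] [[e f] [g h]] /=.
rewrite -subr_ge0.
set D := (X in 0 <= X).
have -> : D = (a * g - b * h - (c * e - d * f)) ^+ 2
            + (a * h + b * g - (c * f + d * e)) ^+ 2 by rewrite /D; ring.
by rewrite addr_ge0 ?sqr_ge0.
Qed.

Lemma chordal_triangle q p r : chordal p r <= chordal p q + chordal q r.
Proof.
have := hcoord_cauchy_schwarz q r; have := hcoord_cauchy_schwarz q p.
have hq2 : (hnorm q ^+ 2)%:C%C =
    (hcoord q).1^*%C * (hcoord q).1 + (hcoord q).2^*%C * (hcoord q).2.
  rewrite /hnorm sqr_sqrtr ?addr_ge0 ?sqr_ge0 // !normc_sq.
  case: (hcoord q) => [[a b] [c d]] /=.
  by apply/eqP; rewrite eq_complex /=; apply/andP; split; apply/eqP; ring.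
have := hnorm_gt0 p; have := hnorm_gt0 q; have := hnorm_gt0 r.
move: hq2; rewrite /chordal.
move: (hnorm p) (hnorm q) (hnorm r) => np nq nr.
case: (hcoord p) (hcoord q) (hcoord r) => [p1 p2] [q1 q2] [r1 r2] /=.
move=> hq2 nr0 nq0 np0 csqp csqr.
have key : nq ^+ 2 * normc (p1 * r2 - p2 * r1) <=
    normc (p1 * q2 - p2 * q1) * (nq * nr)
    + normc (q1 * r2 - q2 * r1) * (nq * np).
  rewrite -[nq ^+ 2]normc_real ?sqr_ge0 // -normcM hq2.
  have -> : (q1^*%C * q1 + q2^*%C * q2) * (p1 * r2 - p2 * r1) =
    (p1 * q2 - p2 * q1) * (q1^*%C * r1 + q2^*%C * r2)
    + (q1 * r2 - q2 * r1) * (q1^*%C * p1 + q2^*%C * p2) by ring.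
  apply: le_trans (normc_triangle _ _) _; rewrite !normcM.
  by apply: lerD; apply: ler_wpM2l => //; exact: normc_ge0.
move: key; set A := normc _; set B := normc _; set C := normc _ => key.
rewrite -subr_ge0.
have -> : 2 * B / (np * nq) + 2 * C / (nq * nr) - 2 * A / (np * nr) =
  2 / (nq ^+ 2 * np * nr) * (B * (nq * nr) + C * (nq * np) - nq ^+ 2 * A).
  by field; rewrite !gt_eqF.
by rewrite mulr_ge0 ?divr_ge0 ?mulr_ge0 ?sqr_ge0 ?subr_ge0 // ltW.
Qed.

HB.instance Definition _ := Choice.on (P1C R).
HB.instance Definition _ := Pointed.on (P1C R).
HB.instance Definition _ := isMetric.Build R (P1C R)
  chordalxx chordal_positivity chordalC chordal_triangle.

End ChordalMetric.

Section JuliaSet.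
Context {R : realType}.

(* The self-map of P^1(C) induced by a complex polynomial; a polynomial sends
   infinity to infinity unless it is constant. *)
Definition P1map (f : {poly R[i]}) (p : P1C R) : P1C R :=
  match p with
  | Some z => Some f.[z]
  | None => if (size f <= 1)%N then Some f`_0 else None
  end.

(* In [subspace U] the points outside U are isolated, so the condition only
   bears on the points of U. *)
Definition iterates_equicontinuous_on (F : P1C R -> P1C R) (U : set (P1C R)) :=
  equicontinuous [set: nat] (fun n => iter n F : subspace U -> P1C R).

(* As a union this contains every open set of equicontinuity; the two lemmas
   below show that it is one itself, so it is the maximal one. *)
Definition Fatou (F : P1C R -> P1C R) : set (P1C R) :=
  \bigcup_(U in [set U | open U /\ iterates_equicontinuous_on F U]) U.

Lemma Fatou_open F : open (Fatou F).
Proof. by apply: bigcup_open => U []. Qed.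

Lemma Fatou_equicontinuous F : iterates_equicontinuous_on F (Fatou F).
Proof.
move=> x E entE; have [Fx|nFx] := pselect (Fatou F x); last first.
  have : nbhs (x : subspace (Fatou F)) [set x].
    by apply: open_nbhs_nbhs; split => //; exact: open_subspace1out.
  by apply: filterS => _ -> i _; exact: entourage_refl.
have [U [oU eqU] Ux] := Fx.
pose good : set (P1C R) :=
  [set y | forall n, [set: nat] n -> E (iter n F x, iter n F y)].
have nU : nbhs (x : subspace U) good by exact: eqU.
suff : nbhs (x : subspace (Fatou F)) good by [].
rewrite -nbhs_subspace_interior; last first.
  by apply: open_nbhs_nbhs; split => //; exact: Fatou_open.
by rewrite (@nbhs_subspace_interior _ U) //; exact: open_nbhs_nbhs.
Qed.

Definition Julia (F : P1C R -> P1C R) : set (P1C R) := ~` Fatou F.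

Definition Jset (f : {poly R}) : set (P1C R) :=
  Julia (P1map (map_poly (real_complex R) f)).

(* The real line inside P^1(C); it does not contain the point at infinity. *)
Definition real_line : set (P1C R) := [set Some (x%:C)%C | x in [set: R]].

End JuliaSet.

Section CriticalInterval.
Context {R : realType}.

(* [rootsR f] lists the distinct real roots of f (it is empty if f = 0). *)
Definition nb_real_roots (f : {poly R}) : nat :=
  \sum_(x <- rootsR f) mup x f.

Definition critical_interval (f : {poly R}) : set R :=
  [set t | nb_real_roots (f - t%:P) = (size f).-1].

Definition smallest_element (A : set R) (a : R) := A a /\ lbound A a.
Definition largest_element (A : set R) (a : R) := A a /\ ubound A a.

End CriticalInterval.

(* Main.v *)
Require Import Defs.
From mathcomp Require Import all_boot all_order all_algebra.
From mathcomp Require Import all_classical all_reals all_analysis.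
From mathcomp Require Import complex polyrcf.
From mathcomp Require Import ring lra.

Import Order.TTheory GRing.Theory Num.Theory.
Import ComplexField.Normc.

Local Open Scope classical_set_scope.
Local Open Scope ring_scope.

(* Write [K] for [[a1, a2]].  Every point with a bounded complex orbit is real
   when the Julia set is: otherwise a vertical ray issued from it would leave the
   bounded orbits at a non-real point where equicontinuity fails.  Complex fixed
   points, and all complex preimages of [a1] and [a2], have bounded orbits, so
   [a1] and [a2] lie in the critical interval, which is convex.
   Conversely, no [x < a1] or [x > a2] is mapped to [a1] or above, so all complex
   roots of [f = t] lie in [K] for [t] in [K].  For a non-real [z] there is [Q > 1]
   with [|z - r|^2 >= Q (Re z - r)^2] for all [r] in [K]; expanding [f - t] into
   linear factors, induction on [n] yields
   [|f^n z - t|^2 >= Q^(d^n) (f^n (Re z) - t)^2].  As the real number [f^n (Re z)]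
   is at distance at least [(a2 - a1) / 2] from [a1] or from [a2], [f^n z] tends to
   infinity, locally uniformly in [z]. *)

(** * Polynomials that split over the reals, and convexity of the critical interval *)

Section RealRooted.
Context {R : realType}.
Implicit Types (f : {poly R}) (rs : seq R) (z : R[i]).

Local Notation complexp := (map_poly (real_complex R)).

Definition splits_with f rs := f = lead_coef f *: \prod_(r <- rs) ('X - r%:P).

Lemma prod_mup_dvdp f (s : seq R) : f != 0 -> uniq s ->
  \prod_(x <- s) ('X - x%:P) ^+ mup x f %| f.
Proof.
move=> f0; elim: s => [|x s IHs] /=; first by rewrite big_nil dvd1p.
move=> /andP[xs us]; rewrite big_cons Gauss_dvdp.
  by rewrite IHs // andbT -mup_geq.
apply: coprimep_expl; rewrite coprimep_sym coprimep_XsubC.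
rewrite /root horner_prod prodf_seq_neq0; apply/allP => y ys /=.
rewrite horner_exp hornerXsubC expf_neq0 // subr_eq0.
by apply: contra xs => /eqP ->.
Qed.

(** The product of the linear factors at the real roots, taken with multiplicity, divides [f];
    having the same degree, it equals [f] up to a constant. *)
Lemma splits_of_nb_real_roots f : f != 0 ->
  nb_real_roots f = (size f).-1 -> exists rs, splits_with f rs.
Proof.
move=> f0 nbf.
pose q := \prod_(x <- rootsR f) ('X - x%:P) ^+ mup x f.
have [rs qrs szrs] : exists2 rs, q = \prod_(r <- rs) ('X - r%:P)
    & size rs = nb_real_roots f.
  exists (flatten [seq nseq (mup x f) x | x <- rootsR f]).
    rewrite big_flatten big_map; apply: eq_bigr => x _.
    by rewrite big_nseq iter_mulr_1.
  rewrite size_flatten /shape -map_comp sumnE big_map.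
  by apply: eq_bigr => x _ /=; rewrite size_nseq.
have fq : q %| f by apply: prod_mup_dvdp => //; exact: uniq_roots.
have /eqpfP : f %= q.
  rewrite eqp_sym -(dvdp_size_eqp fq) qrs size_prod_XsubC szrs nbf prednK //.
  by rewrite size_poly_gt0.
have -> : lead_coef q = 1 by rewrite qrs lead_coef_prod_XsubC.
by rewrite divr1 qrs => ->; exists rs; rewrite /splits_with lead_coefZ
  lead_coef_prod_XsubC mulr1.
Qed.

(** The multiplicity of [x] is its number of occurrences in [rs], so exchanging the two sums lets
    each entry of [rs] count once. *)
Lemma nb_real_roots_of_splits f rs : f != 0 -> splits_with f rs ->
  nb_real_roots f = (size f).-1.
Proof.
move=> f0 frs; have lf0 : lead_coef f != 0 by rewrite lead_coef_eq0.
rewrite [in RHS]frs size_scale // size_prod_XsubC /= /nb_real_roots.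
have mupE x : mup x f = count_mem x rs.
  rewrite frs -mul_polyC mupMr ?mu_prod_XsubC //.
  by rewrite rootC.
under eq_bigr do rewrite mupE -sum1_count big_mkcond.
rewrite exchange_big /= -sum1_size; apply: eq_big_seq => r rrs.
rewrite -big_mkcond sum1_count (eq_count (a2 := pred1 r)); last first.
  by move=> x /=; rewrite eq_sym.
rewrite count_uniq_mem ?uniq_roots // -roots_on_rootsR // in_itv /=.
by rewrite frs rootZ // root_prod_XsubC rrs.
Qed.

(** The complex roots equal their real parts, and injectivity of the coefficient embedding brings
    the complex factorization back to the reals. *)
Lemma splits_of_real_roots f : f != 0 ->
  (forall z, root (complexp f) z -> complex.Im z = 0) ->
  exists rs, splits_with f rs.
Proof.
move=> f0 realf.
have [zs fzs] := closed_field_poly_normal (complexp f).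
exists [seq complex.Re z | z <- zs].
apply: (@map_poly_inj _ _ (real_complex R)).
rewrite [LHS]fzs map_polyZ rmorph_prod big_map lead_coef_map; congr (_ *: _).
apply: eq_big_seq => z zzs /=.
rewrite rmorphB /= map_polyX map_polyC /=; congr (_ - _%:P).
have : root (complexp f) z.
  by rewrite fzs rootZ ?root_prod_XsubC // lead_coef_eq0 map_poly_eq0.
by case: z {zzs} => a b /realf /= ->.
Qed.

(** For real [r], [|z - r|^2 = (Re z - r)^2 + (Im z)^2]. Both the convexity and the expansion
    arguments rest on this product. *)
Lemma normc_sq_splits f rs z : splits_with f rs ->
  normc (complexp f).[z] ^+ 2 = lead_coef f ^+ 2 *
    \prod_(r <- rs) ((complex.Re z - r) ^+ 2 + complex.Im z ^+ 2).
Proof.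
move=> fE; rewrite fE map_polyZ rmorph_prod hornerZ horner_prod -fE.
rewrite normcM exprMn normc_sq /= expr0n /= addr0; congr (_ * _).
elim: rs {fE} => [|r rs IH]; first by rewrite !big_nil normc1 expr1n.
rewrite !big_cons normcM exprMn IH; congr (_ * _).
rewrite normc_sq rmorphB /= map_polyX map_polyC hornerXsubC.
by case: z {IH} => a b /=; rewrite subr0.
Qed.

Lemma horner_sq_splits f rs x : splits_with f rs ->
  f.[x] ^+ 2 = lead_coef f ^+ 2 * \prod_(r <- rs) (x - r) ^+ 2.
Proof.
move=> fE; have := normc_sq_splits f rs (x%:C)%C fE.
rewrite horner_map normc_sq /= expr0n /= addr0 => ->.
by congr (_ * _); apply: eq_bigr => r _; rewrite addr0.
Qed.

(** Passing from [Re z] to [z] adds [(Im z)^2 > 0] to every factor, and positive degree provides at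
    least one factor. *)
Lemma sq_lt_splits f rs z : (1 < size f)%N -> splits_with f rs ->
  complex.Im z != 0 ->
  f.[complex.Re z] ^+ 2 < normc (complexp f).[z] ^+ 2.
Proof.
move=> szf fE z0; rewrite (normc_sq_splits _ _ _ fE) (horner_sq_splits _ _ _ fE).
have f0 : f != 0 by rewrite -size_poly_gt0; exact: leq_trans szf.
have lf : lead_coef f != 0 by rewrite lead_coef_eq0.
rewrite ltr_pM2l ?exprn_even_gt0 //.
have : (0 < size rs)%N.
  by move: szf; rewrite fE size_scale // size_prod_XsubC.
have y2 : 0 < complex.Im z ^+ 2 by rewrite exprn_even_gt0.
elim: rs {fE} => // r rs; case: rs => [|r' rs] IH _.
  by rewrite !big_seq1 ltrDl.
rewrite big_cons [X in _ < X]big_cons ltr_pM ?sqr_ge0 ?ltrDl //; last exact: IH.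
by apply: prodr_ge0 => *; exact: sqr_ge0.
Qed.

(* If [f z = u] with [z] not real, then [f (Re z)] is strictly closer than [u]
   both to [s] and to [t], which is absurd for [u] in [[s, t]]. *)
Lemma critical_interval_convex f (s t u : R) : (1 < size f)%N ->
  critical_interval f s -> critical_interval f t -> s <= u <= t ->
  critical_interval f u.
Proof.
move=> szf Is It /andP[su ut].
have szB v : size (f - v%:P) = size f.
  by rewrite size_polyDl // size_polyN (leq_ltn_trans (size_polyC_leq1 v)).
have fB0 v : f - v%:P != 0.
  by rewrite -size_poly_gt0 szB; exact: leq_trans szf.
have splitI v : critical_interval f v -> exists rs, splits_with (f - v%:P) rs.
  by move=> Iv; apply: splits_of_nb_real_roots; rewrite ?szB.
have [rs fs] := splitI s Is; have [rt ft] := splitI t It.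
suff [ru fu] : exists rs, splits_with (f - u%:P) rs.
  by rewrite /critical_interval /= (nb_real_roots_of_splits _ _ (fB0 u) fu) szB.
apply: splits_of_real_roots => // z; rewrite /root rmorphB /= map_polyC.
rewrite hornerD hornerN hornerC subr_eq0 => /eqP fz.
apply/eqP; apply: contraT => zN.
have := sq_lt_splits _ _ z _ fs zN; have := sq_lt_splits _ _ z _ ft zN.
rewrite !szB => /(_ szf) + /(_ szf).
rewrite !rmorphB /= !map_polyC !(hornerD, hornerN, hornerC) fz -!rmorphB.
rewrite !normc_sq /= expr0n /= !addr0.
set a := f.[_] => at_lt as_lt; have [au|ua] := leP a u; nra.
Qed.

End RealRooted.

(** * Chordal against Euclidean distance, and equicontinuity at a point *)

Section Chordal.
Context {R : realType}.
Implicit Types (z w : R[i]) (p q : P1C R).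

Lemma normc_distC z w : normc (z - w) = normc (w - z).
Proof. by rewrite -normcN opprB. Qed.

Lemma normcB_ge z w : normc z - normc w <= normc (z - w).
Proof. by rewrite lerBlDr -{1}(subrK w z) normc_triangle. Qed.

Lemma hnormE z : hnorm (Some z) = Num.sqrt (1 + normc z ^+ 2).
Proof.
rewrite /hnorm addrC; congr (Num.sqrt (_ + _)).
by rewrite -[RHS](expr1n _ 2) -[in RHS](normc1 R).
Qed.

Lemma hnorm_infty : hnorm (None : P1C R) = 1.
Proof.
suff -> : hnorm (None : P1C R)
    = Num.sqrt (normc (1 : R[i]) ^+ 2 + normc (0 : R[i]) ^+ 2).
  by rewrite normc1 normc0 expr1n expr0n addr0 sqrtr1.
by [].
Qed.

Lemma hnorm_ge1 z : 1 <= hnorm (Some z).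
Proof. by rewrite hnormE -[X in X <= _]sqrtr1 ler_wsqrtr // lerDl sqr_ge0. Qed.

Lemma hnorm_ge z : normc z <= hnorm (Some z).
Proof.
rewrite hnormE -[X in X <= _]ger0_norm ?normc_ge0 // -sqrtr_sqr ler_wsqrtr //.
by rewrite lerDr.
Qed.

Lemma hnorm_le z : hnorm (Some z) <= 1 + normc z.
Proof.
have z0 := normc_ge0 z.
rewrite hnormE -[X in _ <= X]ger0_norm ?addr_ge0 // -sqrtr_sqr ler_wsqrtr //.
by nra.
Qed.

Lemma chordalE z w :
  chordal (Some z) (Some w) = 2 * normc (z - w) / (hnorm (Some z) * hnorm (Some w)).
Proof. by rewrite /chordal mulr1 mul1r. Qed.

Lemma chordal_inftyE z : chordal (Some z) None = 2 / hnorm (Some z).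
Proof.
by rewrite /chordal hnorm_infty mulr1 mulr0 mul1r sub0r normcN normc1 mulr1.
Qed.

Lemma chordal_le z w : chordal (Some z) (Some w) <= 2 * normc (z - w).
Proof.
rewrite chordalE ler_pdivrMr ?mulr_gt0 ?hnorm_gt0 //.
rewrite ler_peMr ?mulr_ge0 ?normc_ge0 // -[1]mulr1.
by apply: ler_pM => //; exact: hnorm_ge1.
Qed.

Lemma chordal_infty_le z : 0 < normc z -> chordal (Some z) None <= 2 / normc z.
Proof.
by move=> z0; rewrite chordal_inftyE ler_pM2l // lef_pV2 ?posrE ?hnorm_gt0 ?hnorm_ge.
Qed.

Lemma chordal_infty_ge z : 2 / (1 + normc z) <= chordal (Some z) None.
Proof.
rewrite chordal_inftyE ler_pM2l // lef_pV2 ?posrE ?hnorm_gt0 ?hnorm_le //.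
by rewrite ltr_pwDl ?normc_ge0.
Qed.

Lemma chordal_ball_finite z (e : R) : 0 < e -> exists2 d, 0 < d &
  forall q, chordal (Some z) q < d -> exists2 w, q = Some w & normc (w - z) < e.
Proof.
move=> e0; have hz := hnorm_gt0 (Some z); have nz := normc_ge0 z.
set h := hnorm (Some z) in hz *; set a := normc z in nz *.
(* The bound [1 / h] keeps infinity, at distance [2 / h], out of the ball. The other one yields
   [2 D < d h (1 + a + D) <= e + D] for [D = |z - w|]. *)
pose d := Num.min (1 / h) (e / (h * (1 + a))).
have d0 : 0 < d by rewrite lt_min !divr_gt0 ?mulr_gt0 // ltr_pwDl.
have d1 : d * h <= 1 by rewrite -ler_pdivlMr // ge_min lexx.
have d2 : d * h * (1 + a) <= e.
  by rewrite -mulrA -ler_pdivlMr ?mulr_gt0 ?ltr_pwDl // ge_min lexx orbT.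
exists d => // -[w|]; last first.
  by rewrite chordal_inftyE -/h ltr_pdivrMr // => ?; exfalso; lra.
rewrite chordalE ltr_pdivrMr ?mulr_gt0 ?hnorm_gt0 // => zw.
exists w => //; rewrite normc_distC.
have D0 := normc_ge0 (z - w); have := hnorm_le w.
have : normc w <= a + normc (z - w).
  by rewrite -lerBlDl normc_distC normcB_ge.
move: zw; rewrite -/h; set D := normc (z - w) in D0 *.
set k := hnorm (Some w); set b := normc w => zw bD kb.
have dh0 : 0 < d * h by rewrite mulr_gt0.
have : d * (h * k) <= d * h * (1 + a + D).
  by rewrite mulrA ler_pM2l // (le_trans kb) // -addrA lerD2l.
have : d * h * D <= D by rewrite ler_piMl.
by nra.
Qed.

Lemma chordal_ball_infty (B : R) : 0 <= B -> exists2 d, 0 < d &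
  forall w, chordal None (Some w) < d -> B <= normc w.
Proof.
move=> B0; have B1 : 0 < 1 + B by rewrite ltr_pwDl.
exists (2 / (1 + B)); first by rewrite divr_gt0.
move=> w; rewrite chordalC => /(le_lt_trans (chordal_infty_ge w)).
rewrite ltr_pM2l // ltf_pV2 ?posrE //; last by rewrite ltr_pwDl ?normc_ge0.
by rewrite ltrD2l => /ltW.
Qed.

Lemma open_chordal (U : set (P1C R)) :
  (forall p, U p -> exists2 d, 0 < d & forall q, chordal p q < d -> U q) ->
  open U.
Proof.
move=> oU; rewrite openE => p /oU [d d0 dU].
by apply/nbhs_ballP; exists d => //= q; rewrite ballEmdist; exact: dU.
Qed.

(** An epsilon-delta form free of subspace topologies; on open sets it amounts to the condition that
    defines [Fatou]. *)
Definition equicontinuous_at (F : P1C R -> P1C R) p := forall e : R, 0 < e ->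
  exists2 d, 0 < d & forall q, chordal p q < d ->
    forall n, chordal (iter n F p) (iter n F q) < e.

Lemma Fatou_equicontinuous_at F p : Fatou F p -> equicontinuous_at F p.
Proof.
move=> [U [oU eU] Up] e e0.
pose E := [set xy : P1C R * P1C R | ball xy.1 e xy.2].
have entE : entourage E by exact: entourage_ball (PosNum e0).
have := eU p E entE; rewrite /prop_near1 -nbhs_subspace_interior; last first.
  exact: open_nbhs_nbhs.
move=> /nbhs_ballP [d /= d0 dE]; exists d => // q pq n.
have /dE/(_ n I) : ball p d q by rewrite ballEmdist.
by rewrite /E /= ballEmdist.
Qed.

Lemma equicontinuous_at_Fatou F (U : set (P1C R)) : open U ->
  (forall p, U p -> equicontinuous_at F p) -> U `<=` Fatou F.
Proof.
move=> oU eU p Up; exists U => //; split => // {p Up} p E entE.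
have [Up|nUp] := pselect (U p); last first.
  have : nbhs (p : subspace U) [set p].
    by apply: open_nbhs_nbhs; split => //; exact: open_subspace1out.
  by apply: filterS => _ -> i _; exact: entourage_refl.
rewrite /prop_near1 -nbhs_subspace_interior; last exact: open_nbhs_nbhs.
move: entE; rewrite -entourage_ballE => -[e /= e0 eE].
have [d d0 dF] := eU p Up e e0; apply/nbhs_ballP; exists d => //= q.
by rewrite ballEmdist => pq n _; apply: eE; rewrite /= ballEmdist; exact: dF.
Qed.

End Chordal.

(** * Escaping and bounded orbits of complex polynomials *)

Section PolynomialDynamics.
Context {R : realType}.
Implicit Types (p : {poly R[i]}) (z w : R[i]).

Local Arguments normc : simpl never.

(** The quotient of [p - p(z)] by [X - z] is bounded on a disc, which gives a Lipschitz bound at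
    [z]. *)
Lemma horner_eps_delta p z (e : R) : 0 < e -> exists2 d, 0 < d &
  forall w, normc (w - z) < d -> normc (p.[w] - p.[z]) < e.
Proof.
move=> e0.
have /factor_theorem [q pq] : root (p - p.[z]%:P) z.
  by rewrite /root !(hornerD, hornerN, hornerC) subrr.
have [M0 qM0] := poly_disk_bound q (normc z + 1)%:C%C.
(* The bound [M0] is a complex number, so its real part is extracted; adding 1 makes [M]
   positive. *)
pose M := `|complex.Re M0| + 1.
have M_gt0 : 0 < M by rewrite ltr_wpDl.
have qM w : normc w <= normc z + 1 -> normc q.[w] <= M.
  move=> wz; have : `|q.[w]| <= M0 by apply: qM0; rewrite -lecR in wz.
  rewrite lecE => /andP[_ qw]; apply: le_trans qw _.
  by apply: le_trans (ler_norm _) _; rewrite lerDl.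
exists (Num.min 1 (e / M)); first by rewrite lt_min ltr01 divr_gt0.
move=> w; rewrite lt_min => /andP[w1]; rewrite ltr_pdivlMr // => wM.
have -> : p.[w] - p.[z] = q.[w] * (w - z).
  have := congr1 (horner^~ w) pq.
  by rewrite !(hornerM, hornerD, hornerN, hornerX, hornerC).
rewrite normcM mulrC; apply: le_lt_trans wM.
rewrite ler_wpM2l ?normc_ge0 // qM //.
by rewrite -lerBlDl (le_trans (normcB_ge _ _)) // ltW.
Qed.

Lemma iter_horner_eps_delta p n z (e : R) : 0 < e -> exists2 d, 0 < d &
  forall w, normc (w - z) < d ->
    normc (iter n (horner p) w - iter n (horner p) z) < e.
Proof.
elim: n e => [|n IH] e e0; first by exists e.
have [d /IH [d' d'0 dd'] de] := horner_eps_delta p (iter n (horner p) z) e e0.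
by exists d' => // w /dd'; exact: de.
Qed.

Lemma iter_P1map p n z :
  iter n (P1map p) (Some z) = Some (iter n (horner p) z).
Proof. by elim: n => //= n ->. Qed.

Lemma iter_P1map_infty p n : (1 < size p)%N ->
  iter n (P1map p) None = None.
Proof. by move=> sp; elim: n => //= n -> /=; rewrite leqNgt sp. Qed.

(** Continuity controls the first [N] iterates; afterwards the orbits of [z] and of its neighbours
    are all chordally close to infinity, hence to one another. *)
Lemma escaping_equicontinuous_at p z (d : R) : 0 < d ->
  (forall B : R, exists N, forall n w, (N <= n)%N -> normc (w - z) < d ->
    B <= normc (iter n (horner p) w)) ->
  equicontinuous_at (P1map p) (Some z).
Proof.
move=> d0 esc e e0.
(* From modulus [8 / e] on, the chordal distance to infinity is at most [e / 4]. *)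
have [N escN] := esc (8 / e).
have [d1 d10 initN] : exists2 d1, 0 < d1 & forall n w, (n < N)%N ->
    normc (w - z) < d1 ->
    normc (iter n (horner p) w - iter n (horner p) z) < e / 4.
  elim: N {escN} => [|N [d1 d10 IH]]; first by exists 1.
  have [|d2 d20 dN] := iter_horner_eps_delta p N z (e / 4).
    by rewrite divr_gt0.
  exists (Num.min d1 d2); first by rewrite lt_min d10.
  move=> n w; rewrite ltnS leq_eqVlt lt_min => /predU1P[->|nN] /andP[w1 w2].
    exact: dN.
  exact: IH.
have [|d' d'0 zd'] := chordal_ball_finite z (Num.min d d1).
  by rewrite lt_min d0.
exists d' => // q /zd' [w ->]; rewrite lt_min => /andP[wd wd1] n.
rewrite !iter_P1map.
have [nN|Nn] := ltnP n N.
  apply: le_lt_trans (chordal_le _ _) _; rewrite normc_distC.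
  by have := initN n w nN wd1; lra.
have far u : normc (u - z) < d ->
    chordal (Some (iter n (horner p) u)) None <= e / 4.
  move=> ud; have B := escN n u Nn ud.
  have B0 : 0 < 8 / e by rewrite divr_gt0.
  apply: le_trans (chordal_infty_le _ (lt_le_trans B0 B)) _.
  rewrite ler_pdivrMr ?(lt_le_trans B0) //.
  have : 8 / e * (e / 4) <= normc (iter n (horner p) u) * (e / 4).
    by rewrite ler_pM2r // divr_gt0.
  have -> : 8 / e * (e / 4) = 2 by field; rewrite gt_eqF.
  by rewrite mulrC.
apply: le_lt_trans (chordal_triangle None _ _) _.
rewrite [chordal None _]chordalC.
have := far z; rewrite subrr normc0 => /(_ d0); have := far w wd; lra.
Qed.

Lemma escape_radius p : (2 < size p)%N -> exists2 r : R, 1 <= r &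
  forall z, r <= normc z -> 2 * normc z <= normc p.[z].
Proof.
move=> sp; have [zs pE] := closed_field_poly_normal p.
have p0 : p != 0 by rewrite -size_poly_gt0 (leq_trans _ sp).
set c := lead_coef p in pE; have cN : c != 0 by rewrite lead_coef_eq0.
have c0 : 0 < normc c.
  rewrite lt_def normc_ge0 andbT; apply: contra cN => /eqP/eq0_normc ->.
  exact: eqxx.
have szs : (1 < size zs)%N.
  by move: sp; rewrite pE size_scale // size_prod_XsubC.
pose S := \sum_(x <- zs) normc x.
have S0 : 0 <= S by apply: sumr_ge0 => x _; exact: normc_ge0.
have zsS x : x \in zs -> normc x <= S.
  move=> xzs; rewrite /S (big_rem x) //= lerDl.
  by apply: sumr_ge0 => y _; exact: normc_ge0.
have c8 : 0 < 8 / normc c by rewrite divr_gt0.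
(* The term [2 * S] gives [|z - x| >= |z| / 2] for every root [x]; the term [2] makes
   [|z| / 2 >= 1], so that two factors suffice; the last term gives [|c| (|z| / 2)^2 >= 2 |z|]. *)
exists (2 + 2 * S + 8 / normc c); first by lra.
move=> z zr.
have z1 : 1 <= normc z / 2 by lra.
have z8 : 8 <= normc c * normc z by rewrite mulrC -ler_pdivrMr //; lra.
have factor x : x \in zs -> normc z / 2 <= normc (z - x).
  by move=> /zsS xS; have := normcB_ge z x; lra.
have -> : normc p.[z] = normc c * \prod_(x <- zs) normc (z - x).
  rewrite pE hornerZ normcM horner_prod; congr (_ * _).
  elim: (zs) => [|x s IH]; first by rewrite !big_nil normc1.
  by rewrite !big_cons normcM IH hornerXsubC.
suff : (normc z / 2) ^+ 2 <= \prod_(x <- zs) normc (z - x).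
  by move=> zz; have := ler_wpM2l (normc_ge0 c) zz; nra.
apply: (@le_trans _ _ ((normc z / 2) ^+ size zs)).
  by rewrite ler_weXn2l.
elim: (zs) factor => [|x s IH] factor; first by rewrite big_nil.
rewrite big_cons exprS ler_pM ?exprn_ge0 ?(le_trans ler01) //.
  by rewrite factor ?mem_head.
by apply: IH => y ys; rewrite factor // in_cons ys orbT.
Qed.

Section EscapeRadius.
Variables (p : {poly R[i]}) (r : R).
Hypotheses (r1 : 1 <= r)
  (pr : forall z, r <= normc z -> 2 * normc z <= normc p.[z]).

Lemma escape_iter n z : r <= normc z ->
  2 ^+ n * normc z <= normc (iter n (horner p) z).
Proof.
move=> rz; have z0 : 0 <= normc z by exact: normc_ge0.
elim: n => [|n IH]; first by rewrite mul1r.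
have rn : r <= normc (iter n (horner p) z).
  apply: le_trans rz _; apply: le_trans IH.
  by rewrite ler_peMl // exprn_ege1 // ler1n.
by apply: le_trans (pr _ rn); rewrite exprS -mulrA ler_pM2l.
Qed.

Lemma unbounded_pow (B a : R) : 0 < a -> exists N, forall n, (N <= n)%N ->
  B <= 2 ^+ n * a.
Proof.
move=> a0; exists (Num.bound (B / a)) => n Nn.
by rewrite -ler_pdivrMr // ltW // upper_nthrootP.
Qed.

(** Beyond radius [r] moduli at least double at each step, so these points together with infinity
    form an open set of equicontinuity. *)
Lemma infty_in_Fatou : (1 < size p)%N -> Fatou (P1map p) None.
Proof.
move=> sp; have r0 : 0 < r by exact: lt_le_trans ltr01 r1.
pose U : set (P1C R) :=
  [set q | if q is Some z then r < normc z else True].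
have oU : open U.
  apply: open_chordal => -[z /= rz|_].
    have [|d d0 dU] := chordal_ball_finite z (normc z - r).
      by rewrite subr_gt0.
    exists d => // q /dU [w -> wz] /=.
    by have := normcB_ge z w; rewrite normc_distC; lra.
  have [|d d0 dU] := chordal_ball_infty (r + 1); first by lra.
  by exists d => // -[w /dU /= ?|//]; lra.
apply: (equicontinuous_at_Fatou _ _ oU) => // -[z /= rz|_].
  apply: (@escaping_equicontinuous_at p z (normc z - r)).
    by rewrite subr_gt0.
  move=> B; have [N NB] := unbounded_pow B r r0.
  exists N => n w Nn wz.
  have rw : r <= normc w by have := normcB_ge z w; rewrite normc_distC; lra.
  apply: le_trans (NB n Nn) _; apply: le_trans (escape_iter n w rw).
  by rewrite ler_wpM2l // exprn_ge0.
move=> e e0.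
(* Modulus at least [4 / e] along the whole orbit keeps it within [e / 2] of infinity. *)
have e4 : 0 < 4 / e by rewrite divr_gt0.
have [|d d0 dB] := chordal_ball_infty (r + 4 / e); first by lra.
exists d => // -[w /dB wB|_] n; last by rewrite iter_P1map_infty // chordalxx.
rewrite iter_P1map_infty // iter_P1map chordalC.
have rw : r <= normc w by lra.
have ew : 4 / e <= normc (iter n (horner p) w).
  apply: le_trans (escape_iter n w rw); apply: (@le_trans _ _ (normc w)).
    by lra.
  by rewrite ler_peMl ?normc_ge0 // exprn_ege1 // ler1n.
apply: le_lt_trans (chordal_infty_le _ (lt_le_trans e4 ew)) _.
rewrite ltr_pdivrMr ?(lt_le_trans e4) //.
have : 4 / e * e <= normc (iter n (horner p) w) * e by rewrite ler_pM2r.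
by rewrite divfK ?gt_eqF //; lra.
Qed.

(* A vertical ray from a bounded orbit leaves the set of bounded orbits at a
   point where bounded and escaping orbits accumulate. *)
Lemma bounded_orbit_real z :
  Julia (P1map p) `<=` real_line ->
  (exists B, forall n, normc (iter n (horner p) z) <= B) ->
  complex.Im z = 0.
Proof.
move=> Jreal [B zB]; have r0 : 0 < r by exact: lt_le_trans ltr01 r1.
apply/eqP; apply: contraT => y0.
(* An orbit that reaches modulus [r] at least doubles from then on, so every bounded orbit stays
   below the common bound [r]. *)
pose bounded w := forall n, normc (iter n (horner p) w) < r.
have bz : bounded z.
  move=> n; rewrite ltNge; apply/negP => rn.
  have [N /(_ N (leqnn N))] := unbounded_pow (B + 1) r r0.
  apply/negP; rewrite -ltNge.
  have := zB (N + n)%N; rewrite iterD => zBn.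
  have := escape_iter N _ rn; have N0 : (0 : R) <= 2 ^+ N by rewrite exprn_ge0.
  have := ler_wpM2l N0 rn; lra.
pose x := complex.Re z; pose y := complex.Im z.
pose ray (s : R) : R[i] := Complex x (s * y).
pose S := [set s : R | bounded (ray s)].
have y_gt0 : 0 < `|y| by rewrite normr_gt0.
have S1 : S 1.
  suff ray1 : ray 1 = z by rewrite /S /= ray1.
  by rewrite /ray mul1r /x /y; case: (z).
have ray_norm s t : normc (ray s - ray t) = `|s - t| * `|y|.
  by rewrite /ray /normc /= subrr expr0n add0r -mulrBl sqrtr_sqr normrM.
have ub_S : ubound S (r / `|y|).
  move=> s Ss; rewrite ler_pdivlMr //; apply: le_trans (ltW (Ss 0%N)).
  apply: (@le_trans _ _ `|s * y|); first by rewrite normrM ler_pM2r // ler_norm.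
  by rewrite /= /ray /normc -sqrtr_sqr ler_wsqrtr // lerDr sqr_ge0.
have supS : has_sup S by split; [exists 1 | exists (r / `|y|)].
have s1 : 1 <= sup S by exact: ub_le_sup supS.2 _ S1.
(* Since [sup S >= 1], this point is not real, hence not in the Julia set. *)
have Fs : Fatou (P1map p) (Some (ray (sup S))).
  apply: contrapT => /Jreal [u _ [_ /esym/eqP]].
  rewrite mulf_eq0 => /orP[/eqP s0|]; last exact: negP y0.
  by move: s1; rewrite s0 ler10.
(* A quarter of [2 / (1 + r)], which bounds from below the distance to infinity of a point of
   modulus less than [r]. *)
pose e := 2 / (1 + r) / 4.
have e0 : 0 < e by rewrite !divr_gt0 //; lra.
have [d d0 dF] := Fatou_equicontinuous_at _ _ Fs e e0.
have near_ray t : `|sup S - t| * `|y| < d / 2 ->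
    chordal (Some (ray (sup S))) (Some (ray t)) < d.
  by move=> tS; apply: le_lt_trans (chordal_le _ _) _; rewrite ray_norm; lra.
(* A displacement of length [d / 4] on the ray: [sup S + h] is outside [S], and some [s] in [S] lies
   above [sup S - h]. *)
pose h := d / 4 / `|y|.
have h0 : 0 < h by rewrite !divr_gt0.
have hy : h * `|y| = d / 4 by rewrite divfK // gt_eqF.
have [s Ss sh] := sup_adherent h0 supS.
have /near_ray/dF Fs1 : `|sup S - s| * `|y| < d / 2.
  have ss : s <= sup S by exact: ub_le_sup supS.2 _ Ss.
  rewrite ger0_norm ?subr_ge0 //.
  have : (sup S - s) * `|y| <= h * `|y| by rewrite ler_pM2r //; lra.
  lra.
have /near_ray/dF Fs2 : `|sup S - (sup S + h)| * `|y| < d / 2.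
  by rewrite opprD addNKr normrN gtr0_norm // hy; lra.
have [m rm] : exists m, r <= normc (iter m (horner p) (ray (sup S + h))).
  apply: contrapT => nm; suff : S (sup S + h).
    by move=> /(ub_le_sup supS.2); lra.
  move=> n; rewrite ltNge; apply/negP => rn; apply: nm; by exists n.
have [N /(_ N (leqnn N)) NB] := unbounded_pow (2 / e) r r0.
have far : 2 / e <= normc (iter (N + m) (horner p) (ray (sup S + h))).
  apply: le_trans NB _; rewrite iterD; apply: le_trans (escape_iter N _ rm).
  by rewrite ler_wpM2l // exprn_ge0.
have e2 : 0 < 2 / e by rewrite divr_gt0.
have := chordal_infty_le _ (lt_le_trans e2 far).
have : 2 / normc (iter (N + m) (horner p) (ray (sup S + h))) <= e.
  by rewrite ler_pdivrMr ?(lt_le_trans e2) // mulrC -ler_pdivrMr.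
have := chordal_infty_ge (iter (N + m) (horner p) (ray s)).
have : 4 * e <= 2 / (1 + normc (iter (N + m) (horner p) (ray s))).
  rewrite /e mulrC divfK // ler_pM2l // lef_pV2 ?posrE; last first.
  - by rewrite ltr_pwDl ?normc_ge0.
  - by lra.
  by rewrite lerD2l ltW.
have := Fs1 (N + m)%N; have := Fs2 (N + m)%N; rewrite !iter_P1map.
(* The iterate of [ray s] is at least [4 e] away from infinity, yet within [2 e] of the iterate of
   [ray (sup S + h)], itself within [e] of infinity. *)
have := chordal_triangle (Some (iter (N + m) (horner p) (ray (sup S + h))))
  (Some (iter (N + m) (horner p) (ray s))) None.
have := chordal_triangle (Some (iter (N + m) (horner p) (ray (sup S))))
  (Some (iter (N + m) (horner p) (ray s)))
  (Some (iter (N + m) (horner p) (ray (sup S + h)))).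
rewrite [chordal (Some (iter _ _ (ray s))) (Some (iter _ _ (ray (sup S))))]chordalC.
lra.
Qed.

End EscapeRadius.

End PolynomialDynamics.

(** * Expansion of non-real orbits *)

Section Expansion.
Context {R : realType}.
Implicit Types (f : {poly R}) (z w : R[i]).

Local Notation complexp := (map_poly (real_complex R)).

Lemma normc_ge_abs_Re z : `|complex.Re z| <= normc z.
Proof.
by case: z => a b; rewrite /normc /= -sqrtr_sqr ler_wsqrtr // lerDl sqr_ge0.
Qed.

Lemma normc_ge_abs_Im z : `|complex.Im z| <= normc z.
Proof.
by case: z => a b; rewrite /normc /= -sqrtr_sqr ler_wsqrtr // lerDr sqr_ge0.
Qed.

Lemma bernoulli_inequality (x : R) n : 0 <= x -> 1 + n%:R * x <= (1 + x) ^+ n.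
Proof.
move=> x0; elim: n => [|n IH]; first by rewrite mul0r addr0 expr0.
rewrite exprS -natr1; have n0 : 0 <= n%:R :> R by exact: ler0n.
have : (1 + x) * (1 + n%:R * x) <= (1 + x) * (1 + x) ^+ n.
  by rewrite ler_wpM2l // addr_ge0.
by apply: le_trans; rewrite -subr_ge0;
  set m := n%:R in n0 *; have := mulr_ge0 n0 (sqr_ge0 x); nra.
Qed.

(** * An interval that contains all complex preimages of its points *)

Section BackwardInvariantInterval.
Variables (f : {poly R}) (a b : R).
Hypotheses (szf : (2 < size f)%N) (ab : a < b)
  (backward : forall t, a <= t <= b -> exists2 rs, splits_with (f - t%:P) rs &
    forall r, r \in rs -> a <= r <= b).

Let d := (size f).-1.

(** The roots [r] of [f - t] stay in [[a, b]], so the induction hypothesis applies to each of the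
    [d] factors [f^n(w) - r]. The comparison is with the orbit of the real number [Re w], not with
    the real parts of the orbit of [w]. *)
Lemma expansion_iter (Q : R) w : 0 <= Q ->
  (forall t, a <= t <= b ->
     Q * (complex.Re w - t) ^+ 2 <= normc (w - (t%:C)%C) ^+ 2) ->
  forall n t, a <= t <= b ->
    Q ^+ (d ^ n) * (iter n (horner f) (complex.Re w) - t) ^+ 2
      <= normc (iter n (horner (complexp f)) w - (t%:C)%C) ^+ 2.
Proof.
move=> Q0 Qw; elim=> [|n IH] t tab; first by rewrite expn0 expr1; exact: Qw.
have [rs frs rsab] := backward t tab.
set X := iter n _ _ in IH *; set W := iter n _ _ in IH *.
have szB : size (f - t%:P) = size f.
  rewrite size_polyDl // size_polyN (leq_ltn_trans (size_polyC_leq1 t)) //.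
  exact: leq_trans szf.
have fN0 : f - t%:P != 0.
  by rewrite -size_poly_gt0 szB; exact: leq_trans szf.
have szrs : size rs = d.
  rewrite /d -szB frs size_scale ?lead_coef_eq0 //.
  by rewrite size_prod_XsubC.
have -> : iter n.+1 (horner f) (complex.Re w) - t = (f - t%:P).[X].
  by rewrite /= !(hornerD, hornerN, hornerC).
have -> : iter n.+1 (horner (complexp f)) w - (t%:C)%C
    = (complexp (f - t%:P)).[W].
  by rewrite /= rmorphB /= map_polyC !(hornerD, hornerN, hornerC).
rewrite (horner_sq_splits _ _ _ frs) (normc_sq_splits _ _ _ frs).
rewrite mulrCA ler_wpM2l ?sqr_ge0 // expnSr exprM.
rewrite -[X in _ ^+ X * _ <= _]szrs.
have : 0 <= Q ^+ (d ^ n) by exact: exprn_ge0.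
move: (Q ^+ (d ^ n)) IH => c IH c0.
elim: (rs) rsab => [|r s IHs] rsab; first by rewrite !big_nil mulr1.
rewrite !big_cons [size _]/= exprS mulrACA.
apply: ler_pM.
- by rewrite mulr_ge0 ?sqr_ge0.
- by rewrite mulr_ge0 ?exprn_ge0 // prodr_ge0 // => i _; exact: sqr_ge0.
- apply: le_trans (IH r (rsab r (mem_head _ _))) _.
  by rewrite normc_sq; case: (W) => u v /=; rewrite subr0.
- by apply: IHs => r' r's; rewrite rsab // in_cons r's orbT.
Qed.

(** One [N] serves all of [D]: this is the uniformity that equicontinuity requires. *)
Lemma nonreal_escape (Q : R) (D : set R[i]) : 1 < Q ->
  (forall w t, D w -> a <= t <= b ->
     Q * (complex.Re w - t) ^+ 2 <= normc (w - (t%:C)%C) ^+ 2) ->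
  forall B : R, exists N, forall n w, (N <= n)%N -> D w ->
    B <= normc (iter n (horner (complexp f)) w).
Proof.
move=> Q1 QD B; pose C := `|B| + `|a| + `|b|.
have C0 : 0 <= C by rewrite !addr_ge0.
pose L := ((b - a) / 2) ^+ 2.
have L0 : 0 < L by rewrite exprn_gt0 // divr_gt0 // subr_gt0.
have Q10 : 0 < Q - 1 by rewrite subr_gt0.
(* By Bernoulli, [Q^(d^n) >= d^n (Q - 1) >= n (Q - 1)], so this choice ensures
   [Q^(d^n) L >= C^2]. *)
exists (Num.bound (C ^+ 2 / (Q - 1) / L)) => n w Nn Dw.
set W := iter n _ w; pose X := iter n (horner f) (complex.Re w).
have nC : C ^+ 2 <= Q ^+ (d ^ n) * L.
  rewrite -ler_pdivrMr // mulrAC in Nn *.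
  have : C ^+ 2 / (Q - 1) / L < n%:R.
    apply: lt_le_trans (archi_boundP _) _; last by rewrite ler_nat mulrAC.
    by rewrite !divr_ge0 ?sqr_ge0 // ltW.
  rewrite mulrAC ltr_pdivrMr // => /ltW /le_trans; apply.
  have : n%:R * (Q - 1) <= (d ^ n)%:R * (Q - 1).
    rewrite ler_pM2r // ler_nat ltnW // ltn_expl //.
    by rewrite /d -ltnS prednK // (leq_trans _ szf).
  move=> /le_trans; apply.
  have := bernoulli_inequality (Q - 1) (d ^ n) (ltW Q10).
  by rewrite subrKC; lra.
(* The endpoint farther from [X] is taken. Then [|W - t| >= C] forces [|W| >= |B|]. *)
have [t [tab tX tC]] : exists t, [/\ a <= t <= b, L <= (X - t) ^+ 2 &
    `|t| <= `|a| + `|b|].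
  have ab' := ab; rewrite /L.
  have [Xm|mX] := leP X ((a + b) / 2).
    exists b; rewrite lexx ltW // lerDr normr_ge0; split => //.
    by nra.
  exists a; rewrite lexx ltW // lerDl normr_ge0; split => //.
  by nra.
have Q0 : 0 <= Q by lra.
have := expansion_iter Q w Q0 (fun t => QD w t Dw) n t tab.
rewrite -/X -/W => XW.
have : C ^+ 2 <= normc (W - (t%:C)%C) ^+ 2.
  apply: le_trans nC _; apply: le_trans XW.
  by rewrite ler_wpM2l // exprn_ge0.
rewrite ler_pXn2r ?nnegrE ?normc_ge0 // => CW.
have := normc_triangle W (- (t%:C)%C); rewrite normcN.
have -> : normc (t%:C)%C = `|t|.
  by rewrite /normc /= expr0n addr0 sqrtr_sqr.
by move: CW; rewrite /C; have := ler_norm B; lra.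
Qed.

(** Around each point of the open set of non-real numbers, a single [Q] works on a small disc,
    whence uniform escape; infinity is treated apart. *)
Lemma Jset_real_of_backward_invariant : Jset f `<=` real_line.
Proof.
have szF : size (complexp f) = size f by exact: size_map_poly.
move=> [z|]; last first.
  have [|r r1 pr] := escape_radius (complexp f); first by rewrite szF.
  move=> nF; exfalso; apply: nF; apply: (infty_in_Fatou _ r) => //.
  by rewrite szF ltnW.
move=> nF; apply: contrapT => nR; apply: nF.
pose U : set (P1C R) :=
  [set q | if q is Some w then complex.Im w != 0 else False].
have oU : open U.
  apply: open_chordal => -[w /= w0|//].
  have [|e e0 eU] := chordal_ball_finite w `|complex.Im w|.
    by rewrite normr_gt0.
  exists e => // q /eU [v -> vw] /=.
  apply: contraTneq vw => v0; rewrite -leNgt.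
  by apply: le_trans (normc_ge_abs_Im _); case: (v) (w) v0 => [? ?] [? ?] /= ->;
    rewrite add0r normrN.
apply: (equicontinuous_at_Fatou _ U oU); last first.
  rewrite /U /=; apply/eqP => z0; apply: nR; exists (complex.Re z) => //.
  by case: (z) z0 => u v /= ->.
move=> {z nR} [z /= y0|//].
have y0' : 0 < `|complex.Im z| by rewrite normr_gt0.
pose y := `|complex.Im z| / 2.
have y_gt0 : 0 < y by rewrite divr_gt0.
apply: (@escaping_equicontinuous_at _ _ _ y) => //.
(* On the disc of radius [y], [|Im w| >= y] and [|Re w - t| <= M] for [t] in [[a, b]], so
   [Q = 1 + y^2 / M^2] is suitable. *)
pose M := normc z + y + `|a| + `|b|.
have M0 : 0 < M by rewrite /M; have := normc_ge0 z; have := normr_ge0 a;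
  have := normr_ge0 b; lra.
have yM : 0 < y ^+ 2 / M ^+ 2 by rewrite divr_gt0 // exprn_gt0.
move=> B.
have [||N NB] := nonreal_escape (1 + y ^+ 2 / M ^+ 2)
  [set w | normc (w - z) < y] _ _ B; last first.
- by exists N => n w Nn wz; exact: NB.
- move=> w t /= wz tab; rewrite mulrDl mul1r.
  have -> : normc (w - (t%:C)%C) ^+ 2
      = (complex.Re w - t) ^+ 2 + complex.Im w ^+ 2.
    by rewrite normc_sq; case: (w) => u v /=; rewrite subr0.
  rewrite lerD2l mulrAC ler_pdivrMr ?exprn_gt0 //.
  have yw : y ^+ 2 <= complex.Im w ^+ 2.
    rewrite -[X in _ <= X]real_normK ?num_real // ler_pXn2r ?nnegrE //; last exact: ltW.
    have : `|complex.Im z - complex.Im w| < y.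
      apply: le_lt_trans wz; apply: le_trans (normc_ge_abs_Im _).
      by rewrite distrC; case: (w) (z) => [? ?] [? ?].
    have := ler_distD 0 (complex.Im z) (complex.Im w).
    have := lerB_dist (complex.Im z) (complex.Im w).
    by rewrite /y; lra.
  have wM : (complex.Re w - t) ^+ 2 <= M ^+ 2.
    rewrite -[X in X <= _]real_normK ?num_real // ler_pXn2r ?nnegrE //; last exact: ltW.
    apply: le_trans (ler_normB _ _) _.
    have := normc_ge_abs_Re w; have := normcB_ge w z.
    have : `|t| <= `|a| + `|b|.
      have /andP[ta tb] := tab; rewrite ler_norml.
      have := ler_norm b; have := ler_norm (- a); rewrite normrN.
      have := normr_ge0 a; have := normr_ge0 b.
      by move=> *; apply/andP; split; lra.
    by move: wz; rewrite /M; lra.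
  by rewrite ler_pM ?sqr_ge0.
- by rewrite ltrDl.
Qed.

End BackwardInvariantInterval.

End Expansion.

(** * Extreme real roots, and the sign beyond them *)

Section RealPolynomials.
Context {R : realType}.
Implicit Types (f g : {poly R}).

Lemma root_extrema g : g != 0 -> (exists x, root g x) ->
  (exists2 a, root g a & forall x, root g x -> a <= x) /\
  (exists2 b, root g b & forall x, root g x -> x <= b).
Proof.
move=> g0 [x gx]; have rootE y : root g y = (y \in rootsR g).
  by rewrite -roots_on_rootsR // in_itv.
have : rootsR g != [::] by apply: contraTneq gx => gn; rewrite rootE gn.
suff ext (s : seq R) : s != [::] ->
    (exists2 a, a \in s & forall y, y \in s -> a <= y) /\
    (exists2 b, b \in s & forall y, y \in s -> y <= b).
  move=> /ext [[a ag ga] [b bg gb]]; split; [exists a | exists b];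
    rewrite ?rootE // => y; rewrite rootE; [exact: ga | exact: gb].
elim: s => // y s IH _; have [->|/IH [[a sa aP] [b sb bP]]] := eqVneq s [::].
  by split; exists y; rewrite ?mem_head // => u; rewrite inE => /eqP ->.
split.
- have [ya|/ltW ay] := leP y a.
    exists y; rewrite ?mem_head // => u; rewrite inE => /predU1P[->//|/aP].
    exact: le_trans.
  by exists a; rewrite ?inE ?sa ?orbT // => u; rewrite inE => /predU1P[->//|/aP].
- have [yb|/ltW by_] := leP y b.
    by exists b; rewrite ?inE ?sb ?orbT // => u; rewrite inE => /predU1P[->//|/bP].
  exists y; rewrite ?mem_head // => u; rewrite inE => /predU1P[->//|/bP ub].
  exact: le_trans ub _.
Qed.

(** As [g] is negative far to the right, a positive value beyond [a] would give a root there by the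
    intermediate value theorem. *)
Lemma horner_lt0_right g (a : R) : lead_coef g < 0 ->
  (forall x, root g x -> x <= a) -> forall x, a < x -> g.[x] < 0.
Proof.
move=> g0 ga x ax; have [|n gn] := @poly_pinfty_gt_lc R (- g).
  by rewrite lead_coefN oppr_gt0.
pose y := Num.max n x; have gy : g.[y] < 0.
  have := gn y; rewrite le_max lexx => /(_ isT).
  by rewrite lead_coefN hornerN lerN2 => /le_lt_trans; apply.
rewrite ltNge; apply/negP; rewrite le_eqVlt => /predU1P[/esym/eqP/ga|gx].
  by rewrite leNgt ax.
have [||u] := @poly_ivtoo R g x y.
- by rewrite le_max lexx orbT.
- by rewrite pmulr_rlt0.
rewrite in_itv /= => /andP[xu _] /ga; rewrite leNgt.
by rewrite (lt_trans ax xu).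
Qed.

(** Odd size means even degree, so [g(-X)] keeps the leading coefficient of [g] and the right-hand
    case applies to it. *)
Lemma horner_lt0_left g (a : R) : odd (size g) -> lead_coef g < 0 ->
  (forall x, root g x -> a <= x) -> forall x, x < a -> g.[x] < 0.
Proof.
move=> og g0 ga x xa; pose h := g \Po (- 'X).
have hE y : h.[y] = g.[- y] by rewrite horner_comp hornerN hornerX.
rewrite -[x]opprK -hE; apply: (horner_lt0_right h (- a)); last by rewrite ltrN2.
  rewrite lead_coef_comp ?size_polyN ?size_polyX // lead_coefN lead_coefX.
  by rewrite -signr_odd; case: (size g) og => //= n /negbTE ->;
    rewrite mulr1.
by move=> y; rewrite /root hE => /ga; rewrite lerNr.
Qed.

End RealPolynomials.

(** * The two implications in even degree *)

Section EvenDegree.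
Context {R : realType}.
Variables (f : {poly R}) (d : nat).
Hypotheses (hdeg : size f = d.+1) (hd : (2 <= d)%N) (heven : ~~ odd d)
  (hlead : lead_coef f < 0).

Local Notation complexp := (map_poly (real_complex R)).
Local Notation fC := (complexp f).

Let szXf : (size ('X : {poly R}) < size f)%N.
Proof. by rewrite size_polyX hdeg. Qed.

Let size_fX : size (f - 'X) = size f.
Proof. by rewrite size_polyDl // size_polyN. Qed.

Let lead_fX : lead_coef (f - 'X) = lead_coef f.
Proof. by rewrite lead_coefDl // size_polyN. Qed.

Let szCf (t : R) : (size (t%:P) < size f)%N.
Proof. by rewrite (leq_ltn_trans (size_polyC_leq1 t)) // hdeg ltnS ltnW. Qed.

Let size_fC t : size (f - t%:P) = size f.
Proof. by rewrite size_polyDl // size_polyN. Qed.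

Let lead_fC t : lead_coef (f - t%:P) = lead_coef f.
Proof. by rewrite lead_coefDl // size_polyN. Qed.

Let root_fX x : root (f - 'X) x <-> f.[x] = x.
Proof.
by rewrite /root !(hornerD, hornerN, hornerX) subr_eq0; split => /eqP.
Qed.

Let root_fC t x : root (f - t%:P) x <-> f.[x] = t.
Proof.
by rewrite /root !(hornerD, hornerN, hornerC) subr_eq0; split => /eqP.
Qed.

Let fC_neq0 t : f - t%:P != 0.
Proof. by rewrite -size_poly_gt0 size_fC hdeg. Qed.

Lemma Jset_real_of_critical_interval a1 a2 :
  smallest_element [set x | f.[x] = x] a1 ->
  largest_element [set x | f.[x] = a1] a2 ->
  `[a1, a2]%classic `<=` critical_interval f -> Jset f `<=` real_line.
Proof.
move=> [/= fa1 lba1] [/= fa2 uba2] I12.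
(* Even degree enters here: [f - X] is negative to the left of its smallest root. *)
have below x : x < a1 -> f.[x] < x.
  move=> xa; rewrite -subr_lt0 -[in X in _ - X](hornerX x) -hornerN -hornerD.
  apply: (horner_lt0_left _ a1) xa; rewrite ?lead_fX // ?size_fX ?hdeg //.
  by move=> y /root_fX; exact: lba1.
have above x : a2 < x -> f.[x] < a1.
  move=> ax; rewrite -subr_lt0 -[in X in _ - X](hornerC a1 x) -hornerN -hornerD.
  apply: (horner_lt0_right _ a2) ax; rewrite ?lead_fC //.
  by move=> y /root_fC; exact: uba2.
have preim x : a1 <= f.[x] -> a1 <= x <= a2.
  move=> fx; apply/andP; split; rewrite leNgt; apply/negP.
    by move=> xa; have := below x xa; lra.
  by move=> /above; lra.
have backward t : a1 <= t <= a2 -> exists2 rs, splits_with (f - t%:P) rs &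
    forall r, r \in rs -> a1 <= r <= a2.
  move=> t12; have It : critical_interval f t by apply: I12; rewrite /= in_itv.
  have [|rs frs] := splits_of_nb_real_roots _ (fC_neq0 t).
    by rewrite size_fC; exact: It.
  exists rs => // r rrs; apply: preim.
  suff -> : f.[r] = t by case/andP: t12.
  by apply/root_fC; rewrite frs rootZ ?lead_coef_eq0 // root_prod_XsubC.
have a12 : a1 <= a2 by exact: uba2.
apply: (Jset_real_of_backward_invariant f a1 a2) => //; first by rewrite hdeg.
rewrite lt_neqAle a12 andbT; apply/eqP => a12E.
(* If [a1 = a2] then [f - a1] is [c (X - a1)^d], which is too flat at [a1] for
   [f x < x] to hold just left of [a1]. *)
have [rs frs rsa] := backward a1 (introT andP (conj (lexx _) a12)).
have szrs : size rs = d.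
  have := size_fC a1; rewrite frs size_scale ?lead_coef_eq0 //.
  by rewrite size_prod_XsubC hdeg => -[].
have fE x : f.[x] - a1 = lead_coef f * (x - a1) ^+ d.
  have -> : f.[x] - a1 = (f - a1%:P).[x] by rewrite !(hornerD, hornerN, hornerC).
  rewrite frs hornerZ lead_fC horner_prod -szrs; congr (_ * _).
  elim: (rs) rsa => [|r s IH] rsa; first by rewrite big_nil.
  rewrite big_cons hornerXsubC exprS IH; last first.
    by move=> r' r's; rewrite rsa // in_cons r's orbT.
  have := rsa r (mem_head _ _); rewrite -a12E.
  by move=> /andP[ar ra]; have -> : r = a1 by apply/eqP; rewrite eq_le ra.
pose c := - lead_coef f; have c0 : 0 < c by rewrite oppr_gt0.
(* This [e] gives [c e^d <= c e^2 <= e], hence [f(a1 - e) >= a1 - e], against [below]. *)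
pose e := Num.min 1 c^-1; have e0 : 0 < e by rewrite lt_min invr_gt0 c0 ltr01.
have e1 : e <= 1 by rewrite ge_min lexx.
have ce : c * e <= 1.
  by rewrite mulrC -ler_pdivlMr // mul1r ge_min lexx orbT.
have := below (a1 - e); rewrite ltrBlDr ltrDl => /(_ e0).
have := fE (a1 - e); rewrite addrAC subrr add0r exprNn.
rewrite -signr_odd (negbTE heven) expr0 mul1r.
have -> : lead_coef f = - c by rewrite opprK.
have : e ^+ d <= e ^+ 2 by rewrite ler_wiXn2l // ltW.
by nra.
Qed.

Lemma bounded_orbit_preimage (p : {poly R[i]}) z :
  (exists B, forall n, normc (iter n (horner p) p.[z]) <= B) ->
  exists B, forall n, normc (iter n (horner p) z) <= B.
Proof.
move=> [B zB]; exists (Num.max B (normc z)) => -[|n].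
  by rewrite le_max lexx orbT.
by rewrite iterSr le_max zB.
Qed.

Lemma critical_interval_of_Jset_real : Jset f `<=` real_line ->
  (exists x : R, f.[x] = x) /\
  (exists a1 a2 : R,
    [/\ smallest_element [set x | f.[x] = x] a1,
        largest_element [set x | f.[x] = a1] a2
      & `[a1, a2]%classic `<=` critical_interval f]).
Proof.
move=> Jreal.
have szfC : size fC = size f by exact: size_map_poly.
have [|r r1 fr] := escape_radius fC; first by rewrite szfC hdeg.
have bounded_real z := bounded_orbit_real fC r r1 fr z Jreal.
have bounded_fix c : fC.[c] = c ->
    exists B, forall n, normc (iter n (horner fC) c) <= B.
  by move=> fc; exists (normc c) => n; rewrite iter_fix.
(* A complex root of [f - X] is a fixed point, so its orbit is bounded and it is real. *)
have [x fx] : exists x : R, f.[x] = x.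
  have /closed_rootP [z] : size (complexp (f - 'X)) != 1%N.
    by rewrite size_map_poly size_fX hdeg eqSS; case: (d) hd.
  rewrite /root rmorphB /= map_polyX !(hornerD, hornerN, hornerX) subr_eq0.
  move=> /eqP fz; have := bounded_real z (bounded_fix z fz).
  case: z fz => a b fz /= b0; rewrite {}b0 in fz.
  exists a; have := horner_map (real_complex R) f a.
  by rewrite /= fz => -[].
split; first by exists x.
have [|[a1 /root_fX fa1 a1min] _] := @root_extrema R (f - 'X) _
    (ex_intro _ x (proj2 (root_fX x) fx)).
  by rewrite -size_poly_gt0 size_fX hdeg.
(* The equation [f(x) = a1] has the solution [a1] itself, hence a largest real one. *)
have [_ [a2 /root_fC fa2 a2max]] := @root_extrema R _ (fC_neq0 a1)
    (ex_intro _ a1 (proj2 (root_fC a1 a1) fa1)).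
have fixC : fC.[(a1%:C)%C] = (a1%:C)%C by rewrite horner_map fa1.
(* Complex preimages of a point with bounded orbit have bounded orbits too, so they are all real. *)
have critical t : (exists B, forall n, normc (iter n (horner fC) (t%:C)%C) <= B) ->
    critical_interval f t.
  move=> tB; have [|rs frs] := splits_of_real_roots (f - t%:P) (fC_neq0 t).
    move=> z; rewrite /root rmorphB /= map_polyC !(hornerD, hornerN, hornerC).
    rewrite subr_eq0 => /eqP fz; apply: bounded_real.
    by apply: bounded_orbit_preimage; rewrite fz.
  rewrite /critical_interval /= (nb_real_roots_of_splits _ _ (fC_neq0 t) frs).
  by rewrite size_fC.
exists a1, a2; split.
- by split => //= y /root_fX; exact: a1min.
- by split => //= y /root_fC; exact: a2max.
- move=> t; rewrite /= in_itv /= => t12.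
  (* The point [a1] is fixed and [a2] is mapped to it, so both endpoints have bounded orbits;
     convexity covers the points between. *)
  apply: critical_interval_convex t12; first by rewrite hdeg ltnS ltnW.
  + by apply: critical; exact: bounded_fix.
  + apply: critical; apply: bounded_orbit_preimage.
    by rewrite horner_map fa2; exact: bounded_fix.
Qed.

End EvenDegree.

Theorem proposition1p4 (R : realType) (f : {poly R}) (d : nat)
    (hdeg : size f = d.+1) (hd : (2 <= d)%N) (heven : ~~ odd d)
    (hlead : lead_coef f < 0) :
  Jset f `<=` real_line <->
  (exists x : R, f.[x] = x) /\
  (exists a1 a2 : R,
    [/\ smallest_element [set x | f.[x] = x] a1,
        largest_element [set x | f.[x] = a1] a2
      & `[a1, a2]%classic `<=` critical_interval f]).
Proof.
split; first exact: (critical_interval_of_Jset_real f d).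
move=> [_ [a1 [a2 [min1 max2 I12]]]].
exact: (Jset_real_of_critical_interval f d hdeg hd heven hlead a1 a2).
Qed.
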